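(* Let $\beta>1$ be a real number. Then $$\underline{D}(\beta)=1\qquad\text{and}\qquad \overline{D}(\beta)\le 1+\tau(\beta).$$
   Context: For a real number $\beta>1$ let $T_\beta:[0,1]\to[0,1]$, $T_\beta x=\beta x-\lfloor\beta x\rfloor$, and for $x\in[0,1]$, $n\ge 1$ let $\varepsilon_n(x,\beta)=\lfloor\beta T_\beta^{n-1}x\rfloor$. For $n\ge1$ the $n$th cylinder of $\beta$ in the parameter space is $$I^P_n(\beta)=\{\beta'\in(1,+\infty):\varepsilon_1(1,\beta')=\varepsilon_1(1,\beta),\ldots,\varepsilon_n(1,\beta')=\varepsilon_n(1,\beta)\},$$ which is an interval; $|I^P_n(\beta)|$ is its length. The lower and upper densities of $\beta$ are $$\underline{D}(\beta)=\liminf_{n\to\infty}\frac{-\log_\beta|I^P_n(\beta)|}{n},\qquad \overline{D}(\beta)=\limsup_{n\to\infty}\frac{-\log_\beta|I^P_n(\beta)|}{n}.$$ For a finite word $\omega=(\omega_1,\ldots,\omega_n)$ the recurrence time is $$\tau(\omega)=\inf\{1\le k<n:(\omega_{k+1},\ldots,\omega_n)=(\omega_1,\ldots,\omega_{n-k})\},$$ with $\tau(\omega)=n$ if no such $k$ exists. The $n$th recurrence time of $\beta$ is $\tau_n(\beta)=\tau(\varepsilon_1(1,\beta),\ldots,\varepsilon_n(1,\beta))$. Set $t_n(\beta)=n-\left\lfloor\frac{n}{\tau_n(\beta)}\right\rfloor\tau_n(\beta)$ and $$\tau(\beta)=\limsup_{n\to\infty}\frac{\tau_n(\beta)-t_n(\beta)}{n}.$$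 *)

(* Defs.v *)
From mathcomp Require Import all_boot all_order all_algebra.
From mathcomp Require Import all_classical all_reals all_analysis.

Set Implicit Arguments.
Unset Strict Implicit.
Unset Printing Implicit Defensive.

Import Order.TTheory GRing.Theory Num.Theory.
Import numFieldNormedType.Exports.

Local Open Scope classical_set_scope.
Local Open Scope ring_scope.

(* T_beta is written on all of R; it maps [0, 1] into itself and is only
   iterated from points of [0, 1]. *)
Definition Tbeta (R : realType) (beta x : R) : R :=
  beta * x - (Num.floor (beta * x))%:~R.

(* Digits are numbered from n = 1; n = 0 is unused. *)
Definition digit (R : realType) (n : nat) (x beta : R) : int :=
  Num.floor (beta * iter n.-1 (Tbeta beta) x).

Definition param_cylinder (R : realType) (n : nat) (beta : R) : set R :=
  [set beta' : R | 1 < beta' /\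
    forall k : nat, (1 <= k <= n)%N -> digit k 1 beta' = digit k 1 beta].

(* Extended-valued logarithm, with log_b 0 = -oo for b > 1. *)
Definition loge (R : realType) (b : R) (x : \bar R) : \bar R :=
  (lne x / (ln b)%:E)%E.

(* The parameter cylinder is an interval, so its length is its Lebesgue
   measure.  The term n = 0 of the following sequences has no meaning and does
   not affect their limits inferior and superior. *)
Definition density_seq (R : realType) (beta : R) (n : nat) : \bar R :=
  (- loge beta (lebesgue_measure (param_cylinder n beta)) / n%:R%:E)%E.

Definition lower_density (R : realType) (beta : R) : \bar R :=
  limn_einf (density_seq beta).

Definition upper_density (R : realType) (beta : R) : \bar R :=
  limn_esup (density_seq beta).

(* The neutral element (size w) is the value when no k qualifies; it exceeds
   every admissible k, so otherwise this is the least such k. *)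
Definition recurrence_time (A : eqType) (w : seq A) : nat :=
  \big[minn/size w]_(1 <= k < size w | drop k w == take (size w - k) w) k.

Definition tau_n (R : realType) (n : nat) (beta : R) : nat :=
  recurrence_time [seq digit k 1 beta | k <- iota 1 n].

Definition t_n (R : realType) (n : nat) (beta : R) : nat :=
  (n - (n %/ tau_n n beta) * tau_n n beta)%N.

Definition tau (R : realType) (beta : R) : \bar R :=
  limn_esup (fun n : nat =>
    (((tau_n n beta)%:R - (t_n n beta)%:R) / n%:R : R)%:E).

(* Main.v *)
Require Import Defs.
From mathcomp Require Import all_boot all_order all_algebra.
From mathcomp Require Import all_classical all_reals all_analysis.
From mathcomp Require Import zify ring lra.
Import Order.TTheory GRing.Theory Num.Theory.
Import numFieldNormedType.Exports.
Local Open Scope ring_scope.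

(** Write w for the digits of 1 in base beta and P_0 = 1,
    P_(n+1) = X P_n - w_(n+1).  As long as x shares its first n digits with
    beta, P_n(x) is the n-th iterate of 1 under T_x, so that the n-th cylinder
    is the set of all x > 1 with 0 <= P_k(x) < 1 for 1 <= k <= n.  Everything
    rests on the way P_n stretches the cylinder.

    The stretching factor is about beta^n, in both directions.  For a <= b,
    the recursion gives P_(n+1)(b) - P_(n+1)(a) =
    b (P_n(b) - P_n(a)) + (b - a) P_n(a); hence the difference is at least
    b^n (b - a) when the P_j(a) are nonnegative, and P_n(b) - P_n(a) is at most
    (b - a) (b^n - 1) / (b - 1) when they are at most 1.  Since P_n maps the
    cylinder into [0, 1), the first bound shows that the cylinder has length
    at most 2 beta^-(n-1), which gives 1 <= lower density.  The second bound
    shows that the length is at least (beta - 1) (P_n(b) - P_n(a)) / b^n for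
    the endpoints a < b.

    For n large, P_n(a) = 0 at the left endpoint.  At the right endpoint b,
    some P_k with 1 <= k <= n reaches 1 while all P_j(b), j <= n, lie in
    (0, 1].  From time k on the orbit repeats itself from the start, so k is a
    period of the word w_1 ... w_n; comparing with the shortest period tau
    gives P_tau(b) = 1, hence P_n(b) = P_t(b) where t = n mod tau.  Climbing
    from P_t(b) to P_tau(b) = 1 takes tau - t steps that each multiply by at
    most b, so P_n(b) >= b^-(tau - t).  As b - beta is exponentially small,
    taking logarithms gives the bound of the upper density
    (near_density_seq_le).

    It remains to find infinitely many n for which P_n(b) stays away from 0
    (frequently_long_image).  If infinitely many digits are nonzero, then
    w_(n+1) >= 1 forces P_n(beta) >= 1 / beta, and P_n(b) >= P_n(beta).  If
    the digits vanish beyond m, then every n > m will do: a period shorter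
    than n sends the nonzero digit w_1 to w_(tau+1), so tau <= m and
    P_n(b) >= b^-m. *)

(** * Iterating x -> b x - w_k with prescribed digits *)

Section OrbitPolynomials.
Variables (R : realType) (w : nat -> int).
Implicit Types (a b x : R) (j k m n r : nat).

(** The iterates of 1 under T_x, for all x with digits w at once; as
    polynomials, they obey the intermediate value theorem over any real closed
    field. *)
Fixpoint orbit_poly n : {poly R} :=
  if n is n'.+1 then 'X * orbit_poly n' - (w n)%:~R%:P else 1.

Local Notation P := orbit_poly.

Lemma orbit_poly0 x : (P 0).[x] = 1.
Proof. by rewrite hornerE. Qed.

Lemma orbit_polyS n x : (P n.+1).[x] = x * (P n).[x] - (w n.+1)%:~R.
Proof. by rewrite /= !hornerE. Qed.

Lemma orbit_poly_ivt a b y n : a <= b -> (P n).[a] <= y <= (P n).[b] ->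
  exists2 c, a <= c <= b & (P n).[c] = y.
Proof.
move=> ab Py; have [|c acb /rootP] := @poly_ivt R (P n - y%:P) a b ab.
  by rewrite !(hornerD (P n)) !hornerN !hornerC subr_le0 subr_ge0.
by rewrite (hornerD (P n)) hornerN hornerC => /eqP; rewrite subr_eq0 => /eqP; exists c.
Qed.

(** Splitting x P_n(x) so that the larger parameter b multiplies the old
    difference is what puts b^n, not a^n, on the left: parameters close to 1
    on the left of beta then cause no loss. *)
Lemma orbit_poly_expands a b n : 0 <= a <= b ->
    (forall j, (j <= n)%N -> 0 <= (P j).[a]) ->
  b ^+ n * (b - a) <= (P n.+1).[b] - (P n.+1).[a].
Proof.
move=> /andP[a0 ab]; elim: n => [|n IH] Pa.
  by rewrite !orbit_polyS !orbit_poly0; lra.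
rewrite (orbit_polyS n.+1) (orbit_polyS n.+1 a).
have {}IH := IH (fun j jn => Pa j (leqW jn)).
have := Pa _ (leqnn _); move: (_.[a]) (_.[b]) IH => u v IH u0.
rewrite exprS; have : b * (b ^+ n * (b - a)) <= b * (v - u) by rewrite ler_wpM2l //; lra.
have : 0 <= (b - a) * u by rewrite mulr_ge0 //; lra.
lra.
Qed.

Lemma orbit_poly_le a b n : 0 <= a <= b ->
    (forall j, (j < n)%N -> 0 <= (P j).[a]) ->
  (P n).[a] <= (P n).[b].
Proof.
case: n => [|n] ab Pa; first by rewrite !orbit_poly0.
rewrite -subr_ge0; apply: le_trans (orbit_poly_expands _ _ n ab Pa).
by rewrite mulr_ge0 ?exprn_ge0 //; lra.
Qed.

Lemma orbit_poly_lt a b n : 0 <= a < b -> (0 < n)%N ->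
    (forall j, (j < n)%N -> 0 <= (P j).[a]) ->
  (P n).[a] < (P n).[b].
Proof.
case: n => // n /andP[a0 ab] _ Pa; have a0b : 0 <= a <= b by lra.
rewrite -subr_gt0; apply: lt_le_trans (orbit_poly_expands _ _ n a0b Pa).
by rewrite mulr_gt0 ?exprn_gt0 //; lra.
Qed.

(** The factor b^n - 1 in place of b^n makes the induction close: it is
    (b - 1) times a geometric sum, and each step adds one more term to that
    sum. *)
Lemma orbit_poly_lipschitz a b n : 1 <= b -> a <= b ->
    (forall j, (j < n)%N -> (P j).[a] <= 1) ->
  (b - 1) * ((P n).[b] - (P n).[a]) <= (b - a) * (b ^+ n - 1).
Proof.
move=> b1 ab; elim: n => [|n IH] Pa.
  by rewrite !orbit_poly0 expr0; lra.
rewrite !orbit_polyS.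
have {}IH := IH (fun j jn => Pa j (leqW jn)).
have := Pa _ (leqnn _); move: (_.[a]) (_.[b]) IH => u v IH u0.
have : b * ((b - 1) * (v - u)) <= b * ((b - a) * (b ^+ n - 1)) by rewrite ler_wpM2l //; lra.
have : 0 <= (b - 1) * ((b - a) * (1 - u)) by rewrite !mulr_ge0 //; lra.
rewrite exprS; lra.
Qed.

(** Two orbits driven by the same digits separate exactly by the factor
    x at each step. *)
Lemma orbit_poly_shift r m x :
    (forall j, (0 < j <= m)%N -> w (r + j)%N = w j) ->
  (P (r + m)).[x] - (P m).[x] = x ^+ m * ((P r).[x] - 1).
Proof.
elim: m => [|m IH] wr; first by rewrite addn0 orbit_poly0 expr0 mul1r.
rewrite addnS !orbit_polyS -addnS wr ?ltn0Sn//=.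
have /IH {}IH: forall j, (0 < j <= m)%N -> w (r + j)%N = w j.
  by move=> j /andP[j0 jm]; rewrite wr // j0 leqW.
by rewrite exprS -mulrA -IH; ring.
Qed.

(** Subtracting nonnegative digits can only slow down the growth.  Read
    backwards, an orbit that reaches 1 cannot have been too close to 0. *)
Lemma orbit_poly_growth k m x : 0 <= x -> (forall j, (0 < j)%N -> 0 <= w j) ->
  (P (k + m)).[x] <= x ^+ m * (P k).[x].
Proof.
move=> x0 w0; elim: m => [|m IH]; first by rewrite addn0 expr0 mul1r.
rewrite addnS orbit_polyS exprS -mulrA lerBlDr.
by rewrite (le_trans (ler_wpM2l x0 IH))// lerDl ler0z w0.
Qed.

(** On (0, 1] the next digit is determined by the current point, because two
    integers that bring the same number into (0, 1] are equal.  Hence an orbit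
    that returns to its starting point 1 repeats itself, digits included. *)
Lemma orbit_poly_periodic k n x : (k <= n)%N ->
    (forall j, (0 < j <= n)%N -> 0 < (P j).[x] <= 1) -> (P k).[x] = 1 ->
  forall j, (k + j <= n)%N -> (P (k + j)).[x] = (P j).[x] /\
    ((0 < j)%N -> w (k + j)%N = w j).
Proof.
move=> kn Px Pk; elim=> [|j IH] kj; first by rewrite addn0 Pk orbit_poly0.
have [|E _] := IH; first by lia.
have wE : w (k + j).+1 = w j.+1.
  have /Px : (0 < (k + j).+1 <= n)%N by lia.
  have /Px : (0 < j.+1 <= n)%N by lia.
  rewrite !orbit_polyS E => /andP[A B] /andP[C D].
  have : (w (k + j).+1)%:~R < (w j.+1 + 1)%:~R :> R by rewrite intrD; lra.
  have : (w j.+1)%:~R < (w (k + j).+1 + 1)%:~R :> R by rewrite intrD; lra.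
  rewrite !ltr_int; lia.
by rewrite addnS; split=> // ; rewrite !orbit_polyS E wE.
Qed.

End OrbitPolynomials.

(** * Endpoints of the cylinder *)

Section CylinderEndpoints.
Variables (R : realType) (w : nat -> int) (beta : R).
Hypothesis beta_gt1 : 1 < beta.
Hypothesis w_ge0 : forall j, (0 < j)%N -> 0 <= w j.
Local Notation P := (orbit_poly R w).
Hypothesis P_beta : forall j, (0 < j)%N -> 0 <= (P j).[beta] < 1.

Let P_beta_ge0 j : 0 <= (P j).[beta].
Proof. by case: j => [|j]; [rewrite orbit_poly0 | case/andP: (P_beta j.+1 isT)]. Qed.

(** By induction on n: if P_(n+1) exceeds 1 at the endpoint found for n, move
    left to the point where P_(n+1) = 1; monotonicity keeps the other
    constraints. *)
Lemma upper_endpoint n : (0 < n)%N -> exists b, [/\ beta < b,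
  forall j, (j <= n)%N -> (P j).[b] <= 1 &
  exists2 k, (0 < k <= n)%N & (P k).[b] = 1].
Proof.
case: n => // n _; elim: n => [|n [b [ltb Pb [k kn Pk]]]].
  (* The solution of P_1 = 1. *)
  exists ((w 1)%:~R + 1).
  have P1 : (P 1).[(w 1)%:~R + 1] = 1 :> R by rewrite orbit_polyS orbit_poly0; ring.
  have := P_beta 1 isT; rewrite orbit_polyS orbit_poly0 => Pb1.
  split; [lra | by case=> [|[|]]// _; rewrite ?orbit_poly0 ?P1 | by exists 1].
have [Pn|Pn] := leP (P n.+2).[b] 1.
  exists b; split=> //; last by exists k => //; lia.
  by move=> j; rewrite leq_eqVlt ltnS => /orP[/eqP -> //|/Pb].
have [|c /andP[bc cb] Pc] := orbit_poly_ivt _ w beta b 1 n.+2 (ltW ltb).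
  by have := P_beta n.+2 isT; lra.
exists c; split; last by exists n.+2; rewrite ?leqnn.
- by rewrite lt_def bc andbT; apply/eqP => cE; have := P_beta n.+2 isT; rewrite -cE Pc; lra.
- move=> j; rewrite leq_eqVlt ltnS => /orP[/eqP -> |/Pb]; first by rewrite Pc.
  apply: le_trans; apply: orbit_poly_le => [|i _].
    by have := beta_gt1; lra.
  by apply: le_trans (P_beta_ge0 i) _; apply: orbit_poly_le => [|l _]; [have := beta_gt1; lra|].
Qed.

(** The same induction on the left of beta, moving right when P_(n+1) becomes
    negative.  No move is needed only at a = 1, the boundary of the parameter
    space, or at a zero of P_n where the next digit is 0, so that P_(n+1)
    vanishes too. *)
Lemma lower_endpoint n : exists a, [/\ 1 <= a <= beta,
  forall j, (j <= n)%N -> 0 <= (P j).[a] & a = 1 \/ (P n).[a] = 0].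
Proof.
elim: n => [|n [a [/andP[a1 ab] Pa a1P]]].
  exists 1; split; [have := beta_gt1; lra | by case=> //; rewrite orbit_poly0 | by left].
have [Pn|Pn] := leP 0 (P n.+1).[a].
  exists a; split; [lra | | ].
    by move=> j; rewrite leq_eqVlt ltnS => /orP[/eqP -> //|/Pa].
  case: a1P => [|Pna]; [by left | right].
  move: Pn; rewrite orbit_polyS Pna mulr0 sub0r.
  by have := w_ge0 n.+1 isT; rewrite -(ler0z R); lra.
have [|c /andP[ac cb] Pc] := orbit_poly_ivt _ w a beta 0 n.+1 ab.
  by rewrite (ltW Pn) P_beta_ge0.
exists c; split; [lra | | by right].
move=> j; rewrite leq_eqVlt ltnS => /orP[/eqP -> |jn]; first by rewrite Pc.
apply: le_trans (Pa j jn) _; apply: orbit_poly_le => [|i ij]; first lra.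
by apply: Pa; lia.
Qed.

End CylinderEndpoints.

(** * Recurrence times as shortest periods *)

Lemma bigminn_le (r : seq nat) (Q : pred nat) m x : x \in r -> Q x ->
  (\big[minn/m]_(i <- r | Q i) i <= x)%N.
Proof.
elim: r => // y r IH; rewrite inE big_cons => /orP[/eqP -> -> | /IH{}IH Qx].
  exact: geq_minl.
by case: ifP => _; rewrite ?geq_min ?IH ?orbT.
Qed.

Lemma bigminn_or (r : seq nat) (Q : pred nat) m :
  let t := (\big[minn/m]_(i <- r | Q i) i)%N in t = m \/ t \in r /\ Q t.
Proof.
move=> t; rewrite {}/t; elim: r => [|y r IH]; first by rewrite big_nil; left.
rewrite big_cons; case: ifP => Qy; last first.
  by case: IH => [->|[tr Qt]]; [left | right; rewrite inE tr orbT].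
rewrite /minn; case: ifP => _; first by right; rewrite mem_head.
by case: IH => [->|[tr Qt]]; [left | right; rewrite inE tr orbT].
Qed.

Section RecurrenceTime.
Variables (A : eqType) (f : nat -> A) (n : nat).
Let word := [seq f k | k <- iota 1 n].

Lemma borderP k : (k <= n)%N -> reflect
  (forall j, (0 < j <= n - k)%N -> f (k + j)%N = f j)
  (drop k word == take (n - k) word).
Proof.
move=> kn; rewrite /word -map_drop -map_take drop_iota take_iota.
rewrite (minn_idPl (leq_subr _ _)) addnC iotaDl -map_comp.
apply: (iffP eqP) => [/eq_in_map E j jn|E].
  by apply: E; rewrite mem_iota; lia.
by apply/eq_in_map => j; rewrite mem_iota => jn; apply: E; lia.
Qed.

Lemma recurrence_time_le k : (0 < k <= n)%N ->
  (forall j, (0 < j <= n - k)%N -> f (k + j)%N = f j) ->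
  (recurrence_time word <= k)%N.
Proof.
rewrite /recurrence_time size_map size_iota.
move=> /andP[k0]; rewrite leq_eqVlt => /orP[/eqP -> _|kn E].
  by elim/big_rec: _ => // i x _ xn; rewrite geq_min xn orbT.
by apply: bigminn_le; [rewrite mem_index_iota k0 | apply/borderP => //; exact: ltnW].
Qed.

Lemma recurrence_time_border : (0 < n)%N ->
  (0 < recurrence_time word <= n)%N /\
  forall j, (0 < j <= n - recurrence_time word)%N -> f (recurrence_time word + j)%N = f j.
Proof.
move=> n0; have := bigminn_or (index_iota 1 (size word))
  (fun k => drop k word == take (size word - k) word) (size word).
rewrite -/(recurrence_time word) size_map size_iota /=.
case=> [-> |[]]; first by split=> [|j]; lia.
by rewrite mem_index_iota => /andP[t0 /ltnW tn] /(borderP _ tn) E; rewrite t0 tn.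
Qed.

End RecurrenceTime.

(** * The orbit at the right endpoint *)

Section RightEndpointOrbit.
Variables (R : realType) (w : nat -> int) (b : R) (n : nat).
Local Notation P := (orbit_poly R w).
Local Notation tau := (recurrence_time [seq w k | k <- iota 1 n]).
Hypothesis n_gt0 : (0 < n)%N.
Hypothesis b_gt0 : 0 < b.
Hypothesis w_ge0 : forall j, (0 < j)%N -> 0 <= w j.
Hypothesis P_b : forall j, (j <= n)%N -> 0 < (P j).[b] <= 1.
Hypothesis P_b_eq1 : exists2 k, (0 < k <= n)%N & (P k).[b] = 1.

(** A time k with P_k(b) = 1 is a period of the word, so tau <= k.  If
    P_tau(b) were less than 1, the orbit from time tau would stay below the
    orbit from time 0, and P_k(b) = 1 would force P_(k - tau)(b) > 1. *)
Lemma orbit_poly_recurrence_time : (P tau).[b] = 1.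
Proof.
have [k /andP[k0 kn] Pk] := P_b_eq1.
have [/andP[t0 tn] wt] := recurrence_time_border _ w n n_gt0.
have tk : (tau <= k)%N.
  apply: recurrence_time_le => [|j jn]; first by rewrite k0.
  have Pb i : (0 < i <= n)%N -> 0 < (P i).[b] <= 1 by move=> /andP[_ /P_b].
  by have [|_ ->] := orbit_poly_periodic _ _ k n b kn Pb Pk j => //; lia.
have : (P (tau + (k - tau))).[b] - (P (k - tau)).[b] = b ^+ (k - tau) * ((P tau).[b] - 1).
  by apply: orbit_poly_shift => j /andP[j0 jk]; rewrite wt // j0 (leq_trans jk) ?leq_sub2r.
rewrite subnKC // Pk => E.
have /andP[_ Pt] := P_b _ tn.
have /andP[_ Pkt] := P_b _ (leq_trans (leq_subr tau k) kn).
apply/eqP; rewrite eq_le Pt -subr_ge0 -(pmulr_rge0 _ (exprn_gt0 (k - tau) b_gt0)) -E.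
by rewrite subr_ge0.
Qed.

Lemma orbit_poly_right_endpoint : (P n).[b] = (P (n %% tau)).[b].
Proof.
have [/andP[t0 tn] _] := recurrence_time_border _ w n n_gt0.
have per j : (tau + j <= n)%N -> (P (tau + j)).[b] = (P j).[b].
  have Pb i : (0 < i <= n)%N -> 0 < (P i).[b] <= 1 by move=> /andP[_ /P_b].
  by move=> /(orbit_poly_periodic _ _ tau n b tn Pb orbit_poly_recurrence_time)[].
rewrite {1}(divn_eq n tau); have := leqnn n; rewrite {1}(divn_eq n tau).
elim: (n %/ tau)%N => [//|q IH]; rewrite mulSn -addnA => qn.
by rewrite per // IH //; lia.
Qed.

(** The orbit needs tau - (n mod tau) more steps to climb back to 1. *)
Lemma orbit_poly_right_endpoint_ge :
  b ^- (tau - n %% tau) <= (P n).[b].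
Proof.
have [/andP[t0 tn] _] := recurrence_time_border _ w n n_gt0.
rewrite orbit_poly_right_endpoint -[leLHS]mulr1 ler_pdivrMl ?exprn_gt0 //.
rewrite -{1}orbit_poly_recurrence_time.
have := orbit_poly_growth _ w (n %% tau) (tau - n %% tau) b (ltW b_gt0) w_ge0.
by rewrite subnKC // ltnW ?ltn_pmod.
Qed.

End RightEndpointOrbit.

(** * Length of the parameter cylinder *)

Section ParameterCylinder.
Variables (R : realType) (beta : R).
Hypothesis beta_gt1 : 1 < beta.
Let w k := digit k 1 beta.
Local Notation P := (orbit_poly R w).
Local Notation mu := (@lebesgue_measure R).

Lemma iter_TbetaE x n :
    (forall k, (0 < k <= n)%N -> digit k 1 x = digit k 1 beta) ->
  iter n (Tbeta x) 1 = (P n).[x].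
Proof.
elim: n => [|n IH] Ex; first by rewrite orbit_poly0.
rewrite orbit_polyS /w -Ex ?ltn0Sn//= /digit /= /Tbeta IH // => k kn.
by apply: Ex; lia.
Qed.

Lemma param_cylinderP n x : param_cylinder n beta x <->
  1 < x /\ forall k, (0 < k <= n)%N -> 0 <= (P k).[x] < 1.
Proof.
split=> -[x1 Ex]; split=> // k.
  case: k => // k kn; rewrite -iter_TbetaE => [|j jk]; last by apply: Ex; lia.
  rewrite /= /Tbeta; have := floor_itv (x * iter k (Tbeta x) 1); rewrite intrD; lra.
elim/ltn_ind: k => -[|k] IH // kn; rewrite /digit /= iter_TbetaE => [|j jk]; last first.
  by apply: IH; lia.
apply: floor_def; have := Ex k.+1 kn.
by rewrite orbit_polyS -[w k.+1]/(digit k.+1 1 beta) intrD /digit /=; lra.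
Qed.

Lemma orbit_poly_beta k : (0 < k)%N -> 0 <= (P k).[beta] < 1.
Proof.
move=> k0; have Ibeta : param_cylinder k beta beta by split.
by have [_] := (param_cylinderP k beta).1 Ibeta; apply; rewrite k0 leqnn.
Qed.

Lemma orbit_poly_beta_ge0 k : 0 <= (P k).[beta].
Proof. by case: k => [|k]; [rewrite orbit_poly0 | case/andP: (orbit_poly_beta k.+1 isT)]. Qed.

Lemma digit_ge0 k : (0 < k)%N -> 0 <= w k.
Proof.
case: k => // k _; rewrite /w /digit iter_TbetaE // floor_ge0.
by rewrite mulr_ge0 ?orbit_poly_beta_ge0 // ltW // (lt_trans ltr01).
Qed.

Lemma digit1_gt0 : 0 < w 1.
Proof. by rewrite /w /digit /= mulr1 gtz0_ge1 floor_ge_int ltW. Qed.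

Lemma param_cylinder_ge0 n x k : param_cylinder n beta x -> (k <= n)%N -> 0 <= (P k).[x].
Proof.
move=> /param_cylinderP[_ Px] kn; case: k kn => [|k] kn; first by rewrite orbit_poly0.
by have /andP[] := Px k.+1 kn.
Qed.

Lemma param_cylinder_interval n : is_interval (param_cylinder n beta).
Proof.
move=> x y Ix Iy z /andP[xz zy].
have [x1 _] := Ix; have [y1 Py] := (param_cylinderP n y).1 Iy.
have Pxz k : (k <= n)%N -> (P k).[x] <= (P k).[z].
  move=> kn; apply: orbit_poly_le => [|j jk]; first lra.
  by apply: param_cylinder_ge0 Ix _; lia.
have Pz k : (k <= n)%N -> 0 <= (P k).[z].
  by move=> kn; rewrite (le_trans _ (Pxz k kn)) // (param_cylinder_ge0 n).
apply/param_cylinderP; split=> [|k kn]; first lra.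
rewrite Pz; last lia.
have /andP[_] := Py _ kn; apply: le_lt_trans; apply: orbit_poly_le => [|j jk]; first lra.
by apply: Pz; lia.
Qed.

Lemma param_cylinder_measurable n : measurable (param_cylinder n beta).
Proof. exact: measurable_realfun.is_interval_measurable (param_cylinder_interval n). Qed.

Lemma param_cylinder_near n x : param_cylinder n.+1 beta x ->
  `|x - beta| <= beta ^- n.
Proof.
move=> Ix; have [x1 _] := Ix.
have Ibeta : param_cylinder n.+1 beta beta by split.
have close a b : param_cylinder n.+1 beta a -> param_cylinder n.+1 beta b ->
    a <= b -> b - a <= b ^- n.
  move=> Ia Ib ab; have [a1 _] := Ia; have [b1 Pb] := (param_cylinderP _ b).1 Ib.
  have bn : 0 < b ^+ n by rewrite exprn_gt0 //; lra.
  rewrite -[leRHS]mulr1 ler_pdivlMl //.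
  have a0b : 0 <= a <= b by lra.
  have := orbit_poly_expands _ w a b n a0b (fun j jn => param_cylinder_ge0 _ _ j Ia (leqW jn)).
  have := param_cylinder_ge0 _ _ _ Ia (leqnn _); have := Pb n.+1 (leqnn _); lra.
have b1 := beta_gt1.
have [xb|bx] := leP x beta; first by rewrite distrC ger0_norm ?close //; lra.
rewrite ger0_norm; last lra.
apply: le_trans (close _ _ Ibeta Ix (ltW bx)) _.
by rewrite lef_pV2 ?posrE ?exprn_gt0 ?lerXn2r ?nnegrE //; lra.
Qed.

Lemma param_cylinder_measure_le n :
  (mu (param_cylinder n.+1 beta) <= (2 * beta ^- n)%:E)%E.
Proof.
have r0 : 0 < beta ^- n by rewrite invr_gt0 exprn_gt0 // (lt_trans ltr01).
apply: (@le_trans _ _ (mu `[beta - beta ^- n, beta + beta ^- n]%classic)).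
  apply: le_measure.
  - by rewrite inE; exact: param_cylinder_measurable.
  - by rewrite inE; exact: measurable_itv.
  by move=> x Ix; have := param_cylinder_near n x Ix; rewrite /= in_itv /= ler_norml; lra.
rewrite lebesgue_measure_itv /= lte_fin ifT; last lra.
by rewrite -EFinD lee_fin; lra.
Qed.

(** The largeness assumption on n keeps the left endpoint a away from 1: if
    a were 1, P_n would grow by at least beta^(n-1) (beta - 1) >= 1 between a
    and beta, within [0, 1).  Thus P_n(a) = 0, and the interval ]a, b[ on
    which P_n climbs to P_n(b) lies in the cylinder. *)
Lemma param_cylinder_measure_ge n : (0 < n)%N -> 1 <= beta ^+ n.-1 * (beta - 1) ->
  exists b, [/\ beta < b <= beta + beta ^- n.-1,
    forall j, (j <= n)%N -> 0 < (P j).[b] <= 1,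
    (exists2 k, (0 < k <= n)%N & (P k).[b] = 1),
    (P n).[beta] <= (P n).[b] &
    (((beta - 1) * ((P n).[b] / b ^+ n))%:E <= mu (param_cylinder n beta))%E].
Proof.
move=> n0 n_large; have b1 := beta_gt1.
have [b [ltb Pb1 Pbk]] := upper_endpoint _ w beta beta_gt1 orbit_poly_beta n n0.
have [a [/andP[a1 ab] Pa aP]] := lower_endpoint _ w beta beta_gt1 digit_ge0 orbit_poly_beta n.
have Pb j : (j <= n)%N -> 0 < (P j).[b] <= 1.
  move=> jn; rewrite Pb1 // andbT; case: j jn => [|j] jn; first by rewrite orbit_poly0.
  apply: le_lt_trans (orbit_poly_beta_ge0 j.+1) _; apply: orbit_poly_lt => //; first lra.
  by move=> i _; apply: orbit_poly_beta_ge0.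
exists b; split=> //.
- rewrite ltb -lerBlDl -[leRHS]mulr1 ler_pdivlMl ?exprn_gt0 //; last lra.
  have bb : 0 <= beta <= b by lra.
  have := orbit_poly_expands _ w beta b n.-1 bb (fun j _ => orbit_poly_beta_ge0 j).
  have := Pb1 _ (leqnn n); have := orbit_poly_beta_ge0 n; rewrite prednK // => A B C.
  have : beta ^+ n.-1 * (b - beta) <= b ^+ n.-1 * (b - beta).
    by rewrite ler_wpM2r ?lerXn2r ?nnegrE //; lra.
  lra.
- by apply: orbit_poly_le => [|j _]; [lra | exact: orbit_poly_beta_ge0].
have Pan : (P n).[a] = 0.
  case: aP => // aE; exfalso; have a0b : 0 <= a <= beta by lra.
  have := orbit_poly_expands _ w a beta n.-1 a0b (fun j jn => Pa j ltac:(lia)).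
  rewrite prednK //; have := orbit_poly_beta n n0; have := Pa n (leqnn n).
  by move: n_large; rewrite -aE; lra.
apply: (@le_trans _ _ (mu `]a, b[%classic)); last first.
  apply: le_measure.
  - by rewrite inE; exact: measurable_itv.
  - by rewrite inE; exact: param_cylinder_measurable.
  move=> x; rewrite /= in_itv /= => /andP[ax xb]; apply/param_cylinderP.
  have Pax k : (k <= n)%N -> (P k).[a] <= (P k).[x].
    by move=> kn; apply: orbit_poly_le => [|j jk]; [lra | apply: Pa; lia].
  have Px k : (k <= n)%N -> 0 <= (P k).[x] by move=> kn; apply: le_trans (Pa k kn) (Pax k kn).
  split=> [|k /andP[k0 kn]]; first lra.
  rewrite Px //; apply: lt_le_trans (Pb1 k kn).
  by apply: orbit_poly_lt => [|//|j jk]; [lra | apply: Px; lia].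
rewrite lebesgue_measure_itv /= lte_fin ifT; last lra.
rewrite -EFinD lee_fin mulrA ler_pdivrMr ?exprn_gt0 //; last lra.
have ab' : a <= b by lra.
have b1' : 1 <= b by lra.
have := orbit_poly_lipschitz _ w a b n b1' ab'.
have Pa1 j : (j < n)%N -> (P j).[a] <= 1.
  move=> jn; apply: le_trans (Pb1 j (ltnW jn)).
  by apply: orbit_poly_le => [|i ij]; [lra | apply: Pa; lia].
move=> /(_ Pa1); rewrite Pan subr0 => L.
have /andP[Pn0 _] := Pb n (leqnn n).
have : (beta - 1) * (P n).[b] <= (b - 1) * (P n).[b] by rewrite ler_wpM2r //; lra.
lra.
Qed.

End ParameterCylinder.

(** * Bounds on limits superior *)

Section LimitSuperior.
Variable R : realType.
Implicit Types (u : nat -> \bar R) (l : \bar R).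
Local Open Scope ereal_scope.

Lemma limn_esup_le_near u l : (\forall n \near \oo%classic, u n <= l) -> limn_esup u <= l.
Proof.
move=> ul; rewrite /limn_esup limf_esupE.
apply: (@le_trans _ _ (ereal_sup (u @` [set n | u n <= l])%classic)).
  by apply: ereal_inf_lbound; exists [set n | u n <= l]%classic.
by apply: ge_ereal_sup => _ [n un <-].
Qed.

Lemma limn_esup_ge_freq u l : (forall N, exists2 n, (N <= n)%N & l <= u n) -> l <= limn_esup u.
Proof.
move=> ul; rewrite /limn_esup limf_esupE.
apply: le_ereal_inf_tmp => _ [V [N _ NV] <-]; have [n Nn lu] := ul N.
by apply: le_trans lu _; apply: ereal_sup_ubound; exists n => //; exact: NV.
Qed.

Lemma limn_esup_lt_near u l : limn_esup u < l -> \forall n \near \oo%classic, u n <= l.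
Proof.
rewrite /limn_esup limf_esupE => /ereal_inf_lt[_ [V VF <-] Vl].
apply: filterS VF => n Vn; apply: le_trans (ltW Vl).
by apply: ereal_sup_ubound; exists n.
Qed.

End LimitSuperior.

(** * The densities *)

Section Densities.
Variables (R : realType) (beta : R).
Hypothesis beta_gt1 : 1 < beta.
Let w k := digit k 1 beta.
Local Notation P := (orbit_poly R w).
Local Notation mu := (@lebesgue_measure R).

Let ln_beta_gt0 : 0 < ln beta. Proof. exact: ln_gt0. Qed.

Lemma density_seqE n : (0 < n)%N ->
  density_seq beta n =
  (- (lne (mu (param_cylinder n beta)) * ((ln beta)^-1)%:E) * (n%:R^-1)%:E)%E.
Proof.
move=> n0; rewrite /density_seq /loge !inver gt_eqF //.
by rewrite gt_eqF // ltr0n.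
Qed.

Lemma density_seq_le n c : (0 < n)%N -> 0 < c ->
  (c%:E <= mu (param_cylinder n beta))%E ->
  (density_seq beta n <= (- (ln c / ln beta) / n%:R)%:E)%E.
Proof.
move=> n0 c0 cmu; rewrite density_seqE // EFinM EFinN EFinM.
rewrite lee_wpmul2r ?lee_fin ?invr_ge0 ?ler0n // leeN2.
rewrite lee_wpmul2r ?lee_fin ?invr_ge0 ?(ltW ln_beta_gt0) // -lne_EFin //.
by rewrite lee_lne // in_itv /= ?measure_ge0 ?leey ?lee_fin ?(ltW c0).
Qed.

Lemma density_seq_ge n c : (0 < n)%N -> 0 < c ->
  (mu (param_cylinder n beta) <= c%:E)%E ->
  ((- (ln c / ln beta) / n%:R)%:E <= density_seq beta n)%E.
Proof.
move=> n0 c0 cmu; rewrite density_seqE // EFinM EFinN EFinM.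
rewrite lee_wpmul2r ?lee_fin ?invr_ge0 ?ler0n // leeN2.
rewrite lee_wpmul2r ?lee_fin ?invr_ge0 ?(ltW ln_beta_gt0) // -lne_EFin //.
by rewrite lee_lne // in_itv /= ?measure_ge0 ?leey ?lee_fin ?(ltW c0).
Qed.

(** The first term accounts for the right endpoint b replacing beta as base
    of the powers (at most 2 n of them), the second one for the constant
    beta - 1 in the bound of the length. *)
Definition density_error n : R :=
  2 * beta ^- n / ln beta + `|ln (beta - 1)| / ln beta / n%:R.

Lemma near_beta_exprVn (e : R) : 0 < e -> \forall n \near \oo%classic, beta ^- n <= e.
Proof.
move=> e0; have b1 : `|beta^-1| < 1.
  by rewrite gtr0_norm ?invf_lt1 ?invr_gt0 // (lt_trans ltr01).
have /cvgr0Pnorm_le /(_ e e0) := cvg_expr b1.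
by apply: filterS => n; rewrite exprVn; apply: le_trans; rewrite ler_norm.
Qed.

Lemma near_density_error (e : R) : 0 < e -> \forall n \near \oo%classic, density_error n <= e.
Proof.
move=> e0; set c := `|ln (beta - 1)| / ln beta.
have c0 : 0 <= c by rewrite divr_ge0 // ltW.
have d0 : 0 < e * ln beta / 4 by rewrite divr_gt0 ?mulr_gt0.
near=> n.
have n0 : 0 < n%:R :> R by rewrite ltr0n; near: n; exact: nbhs_infty_gt.
have A : beta ^- n <= e * ln beta / 4 by near: n; exact: near_beta_exprVn.
have B : 2 * c / e <= n%:R by near: n; exact: nbhs_infty_ger.
rewrite /density_error -/c.
have : 2 * beta ^- n / ln beta <= e / 2 by rewrite ler_pdivrMr //; lra.
have : c / n%:R <= e / 2.
  by rewrite ler_pdivrMr //; move: B; rewrite ler_pdivrMr //; lra.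
lra.
Unshelve. all: by end_near. Qed.

Lemma near_cylinder_large : \forall n \near \oo%classic, 1 <= beta ^+ n.-1 * (beta - 1).
Proof.
have e0 : 0 < (beta - 1) / beta by rewrite divr_gt0 ?subr_gt0 // (lt_trans ltr01).
near=> n.
have n0 : (0 < n)%N by near: n; exact: nbhs_infty_gt.
have : beta ^- n <= (beta - 1) / beta by near: n; exact: near_beta_exprVn.
have b0 : 0 < beta by rewrite (lt_trans ltr01).
rewrite -[leLHS]mulr1 ler_pdivrMl ?exprn_gt0 //.
have -> : beta ^+ n = beta * beta ^+ n.-1 by rewrite -exprS prednK.
suff -> : beta * beta ^+ n.-1 * ((beta - 1) / beta) = beta ^+ n.-1 * (beta - 1) by [].
by field; rewrite gt_eqF.
Unshelve. all: by end_near. Qed.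

(** The length of the cylinder is at least (beta - 1) b^-(n + s), and
    ln b <= ln beta + beta^-n because b / beta <= 1 + beta^-n. *)
Lemma density_seq_right_endpoint_le b n s : (0 < n)%N -> (s <= n)%N ->
    beta < b <= beta + beta ^- n.-1 -> b ^- s <= (P n).[b] ->
    (((beta - 1) * ((P n).[b] / b ^+ n))%:E <= mu (param_cylinder n beta))%E ->
  (density_seq beta n <= (1 + s%:R / n%:R + density_error n)%:E)%E.
Proof.
move=> n0 sn /andP[bb bB] sP Pmu; have b1 := beta_gt1; have l0 := ln_beta_gt0.
have b0 : 0 < b by lra.
pose c := (beta - 1) * (b ^- s * b ^- n).
have c0 : 0 < c by rewrite !mulr_gt0 ?invr_gt0 ?exprn_gt0 //; lra.
have cmu : (c%:E <= mu (param_cylinder n beta))%E.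
  apply: le_trans Pmu; rewrite lee_fin ler_wpM2l ?ler_wpM2r ?invr_ge0 ?exprn_ge0 //; lra.
apply: le_trans (density_seq_le n c n0 c0 cmu) _; rewrite lee_fin.
have lnb : ln b <= ln beta + beta ^- n.
  have -> : b = beta * (1 + (b / beta - 1)) by field; lra.
  have q0 : 0 < b / beta by rewrite divr_gt0 //; lra.
  rewrite lnM ?posrE; [|lra|lra]; rewrite lerD2l.
  apply: le_trans (le_ln1Dx _) _; first lra.
  rewrite lerBlDr ler_pdivrMr; last lra.
  suff -> : (beta ^- n + 1) * beta = beta + beta ^- n.-1 by [].
  rewrite mulrDl mul1r addrC; congr (_ + _).
  by rewrite -{1}(prednK n0) exprS invfM mulrAC mulVf ?mul1r // gt_eqF //; lra.
have nR : 0 < n%:R :> R by rewrite ltr0n.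
have sR : s%:R <= n%:R :> R by rewrite ler_nat.
have lnc : ln c = ln (beta - 1) - (s%:R + n%:R) * ln b.
  rewrite /c -invfM -exprD lnM ?posrE ?invr_gt0 ?exprn_gt0 //; last lra.
  by rewrite lnV ?posrE ?exprn_gt0 // lnXn // -[_ *+ (s + n)]mulr_natl natrD.
rewrite lnc -mulNr -(ler_pM2r nR) mulfVK ?gt_eqF // -(ler_pM2r l0) mulfVK ?gt_eqF //.
have -> : (1 + s%:R / n%:R + density_error n) * n%:R * ln beta =
    (n%:R + s%:R) * ln beta + 2 * n%:R * beta ^- n + `|ln (beta - 1)|.
  by rewrite /density_error; field; rewrite !gt_eqF // exprn_gt0 //; lra.
have : (s%:R + n%:R) * ln b <= (s%:R + n%:R) * (ln beta + beta ^- n).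
  by rewrite ler_wpM2l // addr_ge0.
have : s%:R * beta ^- n <= n%:R * beta ^- n.
  by rewrite ler_wpM2r // invr_ge0 exprn_ge0 //; lra.
have := ler_norm (- ln (beta - 1)); rewrite normrN; lra.
Qed.

(** The cylinders of these orders n are as long as possible, up to a constant
    factor; this is why the lower density does not see tau. *)
Lemma frequently_long_image : exists m, forall N, exists2 n, (N <= n)%N &
  forall b, beta < b -> (forall j, (j <= n)%N -> 0 < (P j).[b] <= 1) ->
    (exists2 k, (0 < k <= n)%N & (P k).[b] = 1) -> (P n).[beta] <= (P n).[b] ->
  b ^- m <= (P n).[b].
Proof.
have b1 := beta_gt1.
have [[m wm]|inf] := pselect (exists m, forall j, (m < j)%N -> w j = 0).
  (* The digits vanish beyond m.  Either the word has no period shorter than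
     n, and P_n(b) = 1, or the shortest one is at most m. *)
  exists m => N; exists (maxn N m.+1) => [|b bb Pb Pbk _]; first exact: leq_maxl.
  set n := maxn N m.+1 in Pb Pbk *.
  have n0 : (0 < n)%N by rewrite (leq_trans _ (leq_maxr _ _)).
  have b0 : 0 < b by lra.
  have := orbit_poly_recurrence_time _ w b n n0 b0 Pb Pbk.
  have := orbit_poly_right_endpoint_ge _ w b n n0 b0 (digit_ge0 _ _ beta_gt1) Pb Pbk.
  have [/andP[]] := recurrence_time_border _ w n n0.
  move: (recurrence_time _) => t t0; rewrite leq_eqVlt => /orP[/eqP -> _ _ ->|tn wt Pn _].
    by rewrite invf_le1 ?exprn_gt0 // exprn_ege1 //; lra.
  apply: le_trans Pn; rewrite lef_pV2 ?posrE ?exprn_gt0 // ler_eXn2l; last lra.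
  rewrite (leq_trans (leq_subr _ _)) // leqNgt; apply/negP => mt.
  have := digit1_gt0 _ _ beta_gt1; rewrite -[digit _ _ _]/(w 1) -wt; last by lia.
  by rewrite wm ?ltxx //; lia.
(* Infinitely many nonzero digits: w_(n+1) >= 1 gives beta P_n(beta) >= 1. *)
exists 1%N => N; have [j Nj wj] : exists2 j, (N < j)%N & w j <> 0.
  apply: contrapT => Nw; apply: inf; exists N => j Nj.
  by apply: contrapT => wj; apply: Nw; exists j.
case: j Nj wj => // n Nn wn; exists n => // b bb _ _; apply: le_trans.
apply: (@le_trans _ _ beta^-1); first by rewrite expr1 lef_pV2 ?posrE //; lra.
rewrite -[leLHS]mulr1 ler_pdivrMl; last lra.
have := orbit_poly_beta_ge0 _ _ beta_gt1 n.+1; rewrite orbit_polyS.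
have : 1 <= (w n.+1)%:~R :> R.
  by rewrite ler1z -gtz0_ge1 lt_def digit_ge0 // andbT; apply/eqP.
by rewrite -/w; lra.
Qed.

Lemma lower_density_ge1 : (1 <= lower_density beta)%E.
Proof.
apply/lee_addgt0Pr => e e0; rewrite /lower_density /limn_einf.
rewrite -leeBlDr // leeNr; apply: limn_esup_le_near.
have l0 := ln_beta_gt0.
have c0 : 0 <= 1 + ln 2 / ln beta by rewrite addr_ge0 // divr_ge0 ?(ltW l0) // ln_ge0 //; lra.
near=> n; have n0 : (0 < n)%N by near: n; exact: nbhs_infty_gt.
have B : (1 + ln 2 / ln beta) / e <= n%:R by near: n; exact: nbhs_infty_ger.
have nR : 0 < n%:R :> R by rewrite ltr0n.
have b0 : 0 < beta by rewrite (lt_trans ltr01).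
rewrite leeN2 //.
have := param_cylinder_measure_le _ beta beta_gt1 n.-1; rewrite prednK // => M.
have d0 : 0 < 2 * beta ^- n.-1 by rewrite mulr_gt0 // invr_gt0 exprn_gt0.
apply: le_trans (density_seq_ge n _ n0 d0 M); rewrite -EFinB lee_fin.
rewrite lnM ?posrE ?invr_gt0 ?exprn_gt0 // lnV ?posrE ?exprn_gt0 // lnXn //.
rewrite -[_ *+ n.-1]mulr_natl.
rewrite ler_pdivlMr // -mulNr ler_pdivlMr //.
have -> : n.-1%:R = n%:R - 1 :> R by rewrite -{2}(prednK n0) -natr1 addrK.
move: B; rewrite ler_pdivrMr // => B.
have := ler_wpM2r (ltW l0) B; rewrite mulrDl mul1r mulfVK ?gt_eqF //; lra.
Unshelve. all: by end_near. Qed.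

Lemma lower_density_le1 : (lower_density beta <= 1)%E.
Proof.
apply/lee_addgt0Pr => e e0; rewrite /lower_density /limn_einf.
rewrite leeNl; apply: limn_esup_ge_freq => N.
have [m freq] := frequently_long_image.
have e20 : 0 < e / 2 by rewrite divr_gt0.
have [N0 _ large] : \forall n \near \oo%classic, [/\ (0 < n)%N, (m <= n)%N,
    1 <= beta ^+ n.-1 * (beta - 1), density_error n <= e / 2 & m%:R / (e / 2) <= n%:R].
  near=> n; split; near: n.
  - exact: nbhs_infty_gt.
  - exact: nbhs_infty_ge.
  - exact: near_cylinder_large.
  - exact: near_density_error.
  - exact: nbhs_infty_ger.
have [n Nn long] := freq (maxn N N0); exists n; first by rewrite (leq_trans _ Nn) ?leq_maxl.
have [|n0 mn nl en mne] := large n; first by rewrite /= (leq_trans _ Nn) ?leq_maxr.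
rewrite leeN2.
have [b [/andP[bb bB] Pb Pbk Pbb Pmu]] := param_cylinder_measure_ge _ _ beta_gt1 n n0 nl.
have bbB : beta < b <= beta + beta ^- n.-1 by rewrite bb.
apply: le_trans (density_seq_right_endpoint_le b n m n0 mn bbB (long b bb Pb Pbk Pbb) Pmu) _.
have nR : 0 < n%:R :> R by rewrite ltr0n.
have : m%:R / n%:R <= e / 2.
  by rewrite ler_pdivrMr //; move: mne; rewrite ler_pdivrMr // mulrC.
by rewrite -EFinD lee_fin; lra.
Unshelve. all: by end_near. Qed.

Lemma t_nE n : t_n n beta = (n %% tau_n n beta)%N.
Proof. by rewrite /t_n {1}(divn_eq n (tau_n n beta)) addKn. Qed.

Lemma tau_n_bounds n : (0 < n)%N ->
  (0 < tau_n n beta <= n)%N /\ (t_n n beta <= tau_n n beta)%N.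
Proof.
move=> n0; have [t0n _] := recurrence_time_border _ w n n0.
by split=> //; rewrite t_nE ltnW // ltn_pmod //; case/andP: t0n.
Qed.

Lemma near_density_seq_le e : 0 < e -> \forall n \near \oo%classic,
  (density_seq beta n <=
   (1 + ((tau_n n beta)%:R - (t_n n beta)%:R) / n%:R + e)%:E)%E.
Proof.
move=> e0; near=> n.
have n0 : (0 < n)%N by near: n; exact: nbhs_infty_gt.
have nl : 1 <= beta ^+ n.-1 * (beta - 1) by near: n; exact: near_cylinder_large.
have en : density_error n <= e by near: n; exact: near_density_error.
have [/andP[t0 tn] tt] := tau_n_bounds n n0.
have [b [bB Pb Pbk Pbb Pmu]] := param_cylinder_measure_ge _ _ beta_gt1 n n0 nl.
have b0 : 0 < b by have := beta_gt1; lra.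
have Pge := orbit_poly_right_endpoint_ge _ w b n n0 b0 (digit_ge0 _ _ beta_gt1) Pb Pbk.
rewrite -natrB // t_nE.
have sn : (tau_n n beta - n %% tau_n n beta <= n)%N by rewrite (leq_trans (leq_subr _ _)).
apply: le_trans (density_seq_right_endpoint_le b n _ n0 sn bB Pge Pmu) _.
by rewrite lee_fin lerD2l.
Unshelve. all: by end_near. Qed.

Lemma tau_ge0 : (0 <= tau beta)%E.
Proof.
apply: limn_esup_ge_freq => N; exists N.+1 => //.
have [_ tt] := tau_n_bounds N.+1 isT.
by rewrite lee_fin divr_ge0 // subr_ge0 ler_nat.
Qed.

Lemma upper_density_le : (upper_density beta <= 1 + tau beta)%E.
Proof.
apply/lee_addgt0Pr => e e0.
have := tau_ge0; case tauE : (tau beta) => [r| |] // _; last by rewrite leey.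
have e20 : 0 < e / 2 by rewrite divr_gt0.
have : (tau beta < (r + e / 2)%:E)%E by rewrite tauE lte_fin; lra.
move=> /limn_esup_lt_near near_tau; apply: limn_esup_le_near.
near=> n.
have T : ((((tau_n n beta)%:R - (t_n n beta)%:R) / n%:R)%:E <= (r + e / 2)%:E)%E.
  by near: n.
apply: (@le_trans _ _ (1 + ((tau_n n beta)%:R - (t_n n beta)%:R) / n%:R + e / 2)%:E).
  by near: n; exact: near_density_seq_le.
by move: T; rewrite -!EFinD !lee_fin; lra.
Unshelve. all: by end_near. Qed.

End Densities.

Theorem lemma3p12 (R : realType) (beta : R) (hbeta : 1 < beta) :
  lower_density beta = 1%E /\ (upper_density beta <= 1 + tau beta)%E.
Proof.
split; last exact: upper_density_le.
by apply/le_anti; rewrite lower_density_le1 ?lower_density_ge1.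
Qed.
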